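(* Let $G_1,\dots,G_n$ be rooted graphs and let $G$ be the decorated path obtained from them, with path vertices $1,\dots,n$. Assume $\alpha_1^G=\alpha_n^G$. Then vertices $1$ and $n$ are strongly cospectral in $G$ if and only if, for every eigenvalue $\theta$ in the eigenvalue support of vertex $1$ (equivalently, of vertex $n$) and every $k\in\{1,\dots,n\}$, $\theta$ is not a pole of $\alpha_k^{G_k}$.
   Context: Graphs are finite and simple. For a graph $H$, $\phi^H$ is the characteristic polynomial of its adjacency matrix $A(H)$, and for a vertex $i$, $\alpha_i^H=\phi^H/\phi^{H\setminus i}$ (rational function in $x$). For an eigenvalue $\theta$ of $A(H)$ let $E_\theta$ be the orthogonal projection onto its eigenspace, and $e_i$ the standard basis vector of vertex $i$. The eigenvalue support of vertex $i$ is the set of eigenvalues $\theta$ with $E_\theta e_i\neq 0$ (equivalently, some $\theta$-eigenvector has a non-zero entry at $i$). Vertices $i,j$ are strongly cospectral if $E_\theta e_i=\pm E_\theta e_j$ for every eigenvalue $\theta$. A rooted graph is a graph with a distinguished root. The decorated path built from pairwise disjoint rooted graphs $G_1,\dots,G_n$ is obtained from the path on vertices $1,\dots,n$ ($i\sim i+1$) by identifying the root of $G_i$ with vertex $i$; $\alpha_i^{G_i}$ is taken at this root. *)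

(* Defs.v *)
From HB Require Import structures.
From mathcomp Require Import all_boot all_order all_algebra.
From mathcomp Require Import fraction.
Set Implicit Arguments. Unset Strict Implicit. Unset Printing Implicit Defensive.
Import Order.TTheory GRing.Theory Num.Theory.
Local Open Scope ring_scope.

(* Graphs: a finite simple graph is a symmetric irreflexive relation [e : rel T]
   on a finite vertex type [T].  Matrices are indexed via [enum_val]/[enum_rank]. *)
Section Spectral.
Variable R : rcfType.

Definition adjmx (T : finType) (e : rel T) : 'M[R]_#|T| :=
  \matrix_(i, j) (e (enum_val i) (enum_val j))%:R.

Definition charp (T : finType) (e : rel T) : {poly R} := char_poly (adjmx e).

Definition delv (T : finType) (e : rel T) (v : T) : rel {x : T | x != v} :=
  fun x y => e (val x) (val y).
Arguments delv {T} e v.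

Definition alpha (T : finType) (e : rel T) (v : T) : {fraction {poly R}} :=
  FracField.tofrac (charp e) / FracField.tofrac (charp (delv e v)).

(* theta is a pole of the rational function p/q (p, q nonzero polynomials):
   the multiplicity of theta as a root of q exceeds that in p *)
Definition is_pole (p q : {poly R}) (theta : R) : bool :=
  (mup theta p < mup theta q)%N.

Definition alpha_pole (T : finType) (e : rel T) (v : T) (theta : R) : bool :=
  is_pole (charp e) (charp (delv e v)) theta.

Definition orthproj n (B : 'M[R]_n) : 'M[R]_n :=
  let C := row_base B in C^T *m invmx (C *m C^T) *m C.

Definition eigproj (T : finType) (e : rel T) (theta : R) : 'M[R]_#|T| :=
  orthproj (eigenspace (adjmx e) theta).

Definition stdvec (T : finType) (v : T) : 'cV[R]_#|T| := delta_mx (enum_rank v) 0.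

Definition Ee (T : finType) (e : rel T) (theta : R) (v : T) : 'cV[R]_#|T| :=
  eigproj e theta *m stdvec v.

Definition eig_support (T : finType) (e : rel T) (v : T) : pred R :=
  fun theta => eigenvalue (adjmx e) theta && (Ee e theta v != 0).

Definition strongly_cospectral (T : finType) (e : rel T) (u v : T) : Prop :=
  forall theta : R, eigenvalue (adjmx e) theta ->
    Ee e theta u = Ee e theta v \/ Ee e theta u = - Ee e theta v.

End Spectral.
Arguments adjmx R {T} e.
Arguments charp R {T} e.
Arguments alpha R {T} e v.
Arguments alpha_pole R {T} e v theta.
Arguments eigproj R {T} e theta.
Arguments stdvec R {T} v.
Arguments Ee R {T} e theta v.
Arguments eig_support R {T} e v.
Arguments strongly_cospectral R {T} e u v.

(* Decorated path.  The path has vertices 0, ..., n (i.e. n+1 path vertices,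
   indexed by 'I_n.+1); G_k has vertex set 'I_(m k), edge relation e k and root r k. *)
Section DecoratedPath.
Variables (n : nat) (m : 'I_n.+1 -> nat).
Variables (e : forall k, rel 'I_(m k)) (r : forall k, 'I_(m k)).

Definition dvert := {k : 'I_n.+1 & 'I_(m k)}.

Definition pathv (k : 'I_n.+1) : dvert := Tagged (fun k => 'I_(m k)) (r k).

Definition dpath : rel dvert := fun x y =>
  [exists k : 'I_n.+1, exists u : 'I_(m k), exists w : 'I_(m k),
     [&& x == Tagged (fun k => 'I_(m k)) u, y == Tagged (fun k => 'I_(m k)) w
       & e u w]]
  || [exists k : 'I_n.+1, exists l : 'I_n.+1,
        (k.+1 == l :> nat) &&
        (((x == pathv k) && (y == pathv l)) || ((x == pathv l) && (y == pathv k)))].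

End DecoratedPath.

(* Main.v *)
Require Import Defs.
From HB Require Import structures.
From mathcomp Require Import all_boot all_order all_algebra.
From mathcomp Require Import fraction perm zify.
Set Implicit Arguments. Unset Strict Implicit. Unset Printing Implicit Defensive.
Import Order.TTheory GRing.Theory Num.Theory.
Local Open Scope ring_scope.

(* The resolvent of a symmetric matrix A has at theta a simple pole whose residue
   is the eigenprojection E.  Hence alpha_1 = alpha_n gives E_11 = E_nn, and by a
   Schur complement theta is a pole of alpha_k iff the branch G_k minus its root
   has a theta-eigenvector y not orthogonal to the neighbours of the root.

   Without poles, the branch G_k contributes a fixed multiple of z_k to the
   eigenvalue equation at k, so the path entries of an eigenvector z satisfy a
   three-term recurrence and z_n = c z_1 for a constant c; then E_11 = E_nn forces
   c = 1 or c = -1.  With a pole at k, every eigenvector has z_k = 0; keeping only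
   its part left of k and correcting the equation at k by a multiple of y gives an
   eigenvector with the same z_1 and with z_n = 0, which strong cospectrality
   forbids when z_1 <> 0. *)

(** * Eigenprojections of symmetric matrices *)

Section SymmetricMatrix.
Variable R : rcfType.

(** The diagonal entries of B B^T are sums of squares, which vanish over an ordered field only
    termwise. *)
Lemma mulmx_tr_eq0 m n (B : 'M[R]_(m, n)) : B *m B^T = 0 -> B = 0.
Proof.
move=> BB0; apply/matrixP => i j; rewrite !mxE.
have /eqP := congr1 (fun M : 'M_m => M i i) BB0.
rewrite !mxE psumr_eq0 => [/allP/(_ j (mem_index_enum j))/=|k _].
  by rewrite mxE mulf_eq0 orbb => /eqP.
by rewrite mxE -expr2 sqr_ge0.
Qed.

(** If w C C^T = 0 then (wC)(wC)^T = 0, so wC = 0 and w = 0. This makes the [invmx] in [orthproj] a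
    genuine inverse. *)
Lemma row_free_gram_unit m n (C : 'M[R]_(m, n)) :
  row_free C -> C *m C^T \in unitmx.
Proof.
move=> fC; rewrite -row_free_unit -kermx_eq0; apply/eqP.
apply: (row_free_inj fC); rewrite mul0mx; apply: mulmx_tr_eq0.
by rewrite trmx_mul mulmxA -[X in X *m _]mulmxA mulmx_ker mul0mx.
Qed.

Section Projection.
Variables (n : nat) (A : 'M[R]_n) (theta : R).
Hypothesis A_sym : A^T = A.
Let E := orthproj (eigenspace A theta).
Let C := row_base (eigenspace A theta).

Let gram_unit : C *m C^T \in unitmx.
Proof. exact/row_free_gram_unit/row_base_free. Qed.

Lemma row_base_eigproj : C *m E = C.
Proof. by rewrite /E /orthproj -/C !mulmxA mulmxV ?mul1mx. Qed.

Lemma eigproj_sym : E^T = E.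
Proof.
rewrite /E /orthproj; move: (row_base _) => D /=.
by rewrite !trmx_mul trmx_inv trmx_mul !trmxK mulmxA.
Qed.

Lemma eigproj_idem : E *m E = E.
Proof.
transitivity (C^T *m invmx (C *m C^T) *m (C *m E)); first by rewrite mulmxA.
by rewrite row_base_eigproj.
Qed.

Lemma sub_eigenspace_eigproj m (v : 'M_(m, n)) :
  (v <= eigenspace A theta)%MS -> v *m E = v.
Proof.
rewrite -(eq_row_base (eigenspace A theta)) -/C => /submxP[w ->].
by rewrite -mulmxA row_base_eigproj.
Qed.

Lemma eigproj_sub : (E <= eigenspace A theta)%MS.
Proof. by rewrite -(eq_row_base (eigenspace A theta)) -/C submxMl. Qed.

Lemma eigproj_mul : E *m A = theta *: E.
Proof. exact/eigenspaceP/eigproj_sub. Qed.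

(** E is symmetric and idempotent, so b^T E b = (E b)^T (E b). *)
Lemma eigproj_quad_eq0 (b : 'cV_n) : b^T *m E *m b = 0 -> E *m b = 0.
Proof.
move=> bEb; apply: trmx_inj; rewrite trmx0; apply: mulmx_tr_eq0.
by rewrite trmxK trmx_mul eigproj_sym mulmxA -[X in X *m b]mulmxA eigproj_idem.
Qed.

(** By symmetry the row space of A - theta is the orthogonal complement of the eigenspace, and 1 - E
    projects onto it. P serves as a partial inverse of A - theta, both in the resolvent expansion
    and for solving linear systems on a branch. *)
Lemma eigproj_compl : exists P : 'M_n, 1%:M - E = P *m (A - theta%:M).
Proof.
apply/submxP; rewrite submxE; set K := cokermx _.
have : (K^T <= eigenspace A theta)%MS.
  apply/sub_kermxP; rewrite -[X in _ *m X]trmxK linearB /= A_sym tr_scalar_mx.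
  by rewrite -trmx_mul mulmx_coker trmx0.
move/sub_eigenspace_eigproj/(congr1 trmx).
by rewrite trmx_mul trmxK eigproj_sym mulmxBl mul1mx => ->; rewrite subrr.
Qed.

(* The resolvent (x - A)^-1 has a simple pole at theta with residue E; clearing
   denominators, this is the expansion of the adjugate at theta. *)
Lemma adj_char_poly_mx_expansion (t := 'X - theta%:P) :
  exists g Q, [/\ char_poly A = t ^+ mup theta (char_poly A) * g,
    ~~ root g theta &
    t *: \adj (char_poly_mx A) =
    t ^+ mup theta (char_poly A) *: (g *: map_mx polyC E + t *: Q)].
Proof.
set phi := char_poly A; set d := mup theta phi; set M := char_poly_mx A.
have phi0 : phi != 0 by rewrite monic_neq0 ?char_poly_monic.
have tphi : t ^+ d %| phi by rewrite -mup_geq.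
have phiE : phi = t ^+ d * (phi %/ t ^+ d) by rewrite mulrC divpK.
have [P PE] := eigproj_compl.
set E' := map_mx polyC E; set P' := map_mx polyC P; set Z := \adj M - E' *m \adj M.
have EM : E' *m M = t *: E'.
  rewrite mulmxBr mul_mx_scalar -map_mxM eigproj_mul map_mxZ.
  by rewrite -scalerBl.
have Eadj : t *: (E' *m \adj M) = phi *: E'.
  by rewrite scalemxAl -EM -mulmxA mul_mx_adj mul_mx_scalar.
have PM : P' *m M = t *: P' - (1%:M - E').
  have -> : M = t%:M - map_mx polyC (A - theta%:M).
    rewrite /M /char_poly_mx map_mxB map_scalar_mx raddfB /= opprB.
    by rewrite addrA subrK.
  by rewrite mulmxBr mul_mx_scalar -map_mxM -PE map_mxB map_mx1.
(* Z is the part of the adjugate off the eigenspace. This identity bootstraps: t^d divides phi, so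
   each substitution of Z into its right-hand side gains a factor t, up to t^d. *)
have ZE : Z = t *: (P' *m Z) + phi *: (P' *m E' - P').
  have : P' *m M *m \adj M = phi *: P' by rewrite -mulmxA mul_mx_adj mul_mx_scalar.
  rewrite PM mulmxBl mulmxBl mul1mx -/Z -scalemxAl => /eqP.
  rewrite subr_eq => /eqP tPadj.
  have -> : t *: (P' *m Z) = t *: (P' *m \adj M) - phi *: (P' *m E').
    rewrite /Z mulmxBr scalerBr; congr (_ - _).
    by rewrite scalemxAr Eadj scalemxAr.
  by rewrite scalerBr addrA subrK tPadj addrC addKr.
have dZ : forall j, (j <= d)%N -> forall i l, t ^+ j %| Z i l.
  elim=> [|j IH] jd i l; first by rewrite expr0 dvd1p.
  rewrite ZE [X in _ %| X]mxE dvdp_add //; last first.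
    by rewrite mxE dvdp_mulr // (dvdp_trans _ tphi) // dvdp_exp2l.
  rewrite mxE exprS dvdp_mul // mxE.
  apply: (big_ind (fun p => t ^+ j %| p)); rewrite ?dvdp0 //.
    by move=> p q; apply: dvdp_add.
  by move=> k _; rewrite dvdp_mull // IH // ltnW.
exists (phi %/ t ^+ d), (map_mx (fun p => p %/ t ^+ d) Z); split=> //.
  have := leqnn d; rewrite {1}/d mup_leq //; apply: contra.
  by rewrite root_factor_theorem => tg; rewrite phiE exprSr dvdp_mul.
have ZQ : t ^+ d *: map_mx (fun p => p %/ t ^+ d) Z = Z.
  by apply/matrixP => i j; rewrite mxE [X in _ * X]mxE mulrC divpK ?dZ.
rewrite scalerDr scalerA -phiE -Eadj scalerA mulrC -scalerA ZQ -scalerDr.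
by rewrite addrC subrK.
Qed.

End Projection.
End SymmetricMatrix.

(** * Eigenfunctions and poles of a graph *)

Section Graph.
Variable R : rcfType.

(** The operator A - theta on functions of vertices, free of the enumeration. For a branch, its
    value at the root is the defect that the rest of the path has to balance. *)
Definition shadj (T : finType) (e : rel T) (theta : R) (f : T -> R) (x : T) : R :=
  \sum_(y | e x y) f y - theta * f x.

Definition eigfun (T : finType) (e : rel T) (theta : R) (f : T -> R) : Prop :=
  forall x, shadj e theta f x = 0.

Definition rvec (T : finType) (f : T -> R) : 'rV[R]_#|T| := \row_i f (enum_val i).

Lemma sum_enum_val (T : finType) (F : T -> R) :
  \sum_(i < #|T|) F (enum_val i) = \sum_x F x.
Proof. by rewrite [RHS](reindex (@enum_val T T)) //; apply/onW_bij/enum_val_bij. Qed.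

Lemma rvec_mul_shift (T : finType) (e : rel T) theta (f : T -> R) :
  symmetric e ->
  rvec f *m (adjmx R e - theta%:M) = rvec (shadj e theta f).
Proof.
move=> es; apply/rowP => j.
rewrite mulmxBr mul_mx_scalar !mxE /shadj; congr (_ - _).
rewrite [RHS]big_mkcond -[RHS]sum_enum_val.
apply: eq_bigr => i _; rewrite !mxE es.
by case: ifP => _; rewrite ?mulr1 ?mulr0.
Qed.

Lemma eigfunP (T : finType) (e : rel T) theta (f : T -> R) :
  symmetric e ->
  eigfun e theta f <-> (rvec f <= eigenspace (adjmx R e) theta)%MS.
Proof.
move=> es; split=> [ef|/sub_kermxP].
  apply/sub_kermxP; rewrite rvec_mul_shift //.
  by apply/rowP => i; rewrite !mxE ef.
rewrite rvec_mul_shift // => /rowP h x.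
by have := h (enum_rank x); rewrite !mxE enum_rankK.
Qed.

Lemma adjmx_sym (T : finType) (e : rel T) : symmetric e -> (adjmx R e)^T = adjmx R e.
Proof. by move=> es; apply/matrixP => i j; rewrite !mxE es. Qed.

Lemma mul_stdvec (T : finType) m (B : 'M[R]_(m, #|T|)) v i :
  (B *m stdvec R v) i 0 = B i (enum_rank v).
Proof. by rewrite -colE mxE. Qed.

Lemma shadj_pairing (T : finType) (e : rel T) theta (f p : T -> R) :
  symmetric e ->
  \sum_x p x * shadj e theta f x = \sum_x f x * shadj e theta p x.
Proof.
move=> es; rewrite /shadj.
under eq_bigr do rewrite mulrBr mulr_sumr.
under [RHS]eq_bigr do rewrite mulrBr mulr_sumr.
rewrite !sumrB; congr (_ - _); last first.
  by apply: eq_bigr => x _; rewrite mulrCA mulrA [LHS]mulrC mulrA.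
rewrite (exchange_big_dep predT) //=; apply: eq_bigr => x _.
by apply: eq_big => [y|y _]; [rewrite es|rewrite mulrC].
Qed.

(** A - theta is self-adjoint, and both sides of [shadj_pairing] reduce to their term at r. With p r
    = 1 the defect of f at r is a fixed multiple of f r; with p r = 0 and nonzero defect of p, f r
    must vanish. *)
Lemma root_pairing (T : finType) (e : rel T) r (theta : R) (f p : T -> R) :
  symmetric e -> (forall x, x != r -> shadj e theta f x = 0) ->
  (forall x, x != r -> shadj e theta p x = 0) ->
  p r * shadj e theta f r = f r * shadj e theta p r.
Proof.
move=> es foff poff; have := shadj_pairing theta f p es.
rewrite (bigD1 r) // big1 /= ?addr0 => [->|x xr]; last by rewrite foff ?mulr0.
by rewrite (bigD1 r) // big1 /= ?addr0 // => x xr; rewrite poff ?mulr0.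
Qed.

Lemma shadjZ (T : finType) (e : rel T) (theta c : R) (f : T -> R) x :
  shadj e theta (fun y => c * f y) x = c * shadj e theta f x.
Proof. by rewrite /shadj mulrBr mulr_sumr mulrCA. Qed.

Lemma shadjB (T : finType) (e : rel T) (theta : R) (f g : T -> R) x :
  shadj e theta (fun y => f y - g y) x = shadj e theta f x - shadj e theta g x.
Proof. by rewrite /shadj sumrB mulrBr !opprD [LHS]addrACA. Qed.

Lemma eigfun_eigproj (T : finType) (e : rel T) theta i :
  symmetric e -> eigfun e theta (fun x => eigproj R e theta i (enum_rank x)).
Proof.
move=> es; apply/eigfunP => //; have := row_sub i (eigproj R e theta).
move/submx_trans/(_ (eigproj_sub _ _)); congr (_ <= _)%MS.
by apply/rowP => j; rewrite !mxE enum_valK.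
Qed.

(** An eigenfunction satisfies f x = f E e_x, and conversely the rows of E are eigenfunctions.
    Strong cospectrality thus becomes a condition on eigenfunction values, with c = 1 or c = -1. *)
Lemma Ee_proportionalP (T : finType) (e : rel T) theta u v (c : R) :
  symmetric e ->
  Ee R e theta v = c *: Ee R e theta u <->
  (forall f, eigfun e theta f -> f v = c * f u).
Proof.
move=> es; split=> [Evu f /eigfunP|h].
  move=> /(_ es)/sub_eigenspace_eigproj fE.
  have fEe x : f x = (rvec f *m Ee R e theta x) 0 0.
    by rewrite /Ee mulmxA fE mul_stdvec mxE enum_rankK.
  by rewrite fEe Evu -scalemxAr mxE -fEe.
apply/colP => i; rewrite [RHS]mxE /Ee !mul_stdvec.
exact: (h (fun x => eigproj R e theta i (enum_rank x)) (eigfun_eigproj _ _ es)).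
Qed.

(** The diagonal entry E_vv is e_v^T E e_v, the squared norm of E e_v. *)
Lemma Ee_diag_eq0 (T : finType) (e : rel T) theta v :
  symmetric e -> eigproj R e theta (enum_rank v) (enum_rank v) = 0 ->
  Ee R e theta v = 0.
Proof.
move=> es d0; apply/eigproj_quad_eq0/matrixP => i j.
rewrite [i]ord1 [j]ord1 -mulmxA mxE (bigD1 (enum_rank v)) //= big1 => [|k kv].
  by rewrite mul_stdvec -/(eigproj R e theta) d0 mulr0 addr0 mxE.
by rewrite !mxE (negPf kv) mul0r.
Qed.

(** By symmetry of E, E_vv = c E_vu = c E_uv = c^2 E_uu. *)
Lemma Ee_proportional_diag (T : finType) (e : rel T) theta u v (c : R) :
  symmetric e -> Ee R e theta v = c *: Ee R e theta u ->
  eigproj R e theta (enum_rank v) (enum_rank v) =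
  c ^+ 2 * eigproj R e theta (enum_rank u) (enum_rank u).
Proof.
move=> es /colP Evu.
have EE i : eigproj R e theta i (enum_rank v) = c * eigproj R e theta i (enum_rank u).
  by have := Evu i; rewrite [RHS]mxE /Ee !mul_stdvec.
have Es i j : eigproj R e theta i j = eigproj R e theta j i.
  by rewrite /eigproj -[in LHS](eigproj_sym (adjmx R e) theta) mxE.
by rewrite EE Es EE mulrA.
Qed.

Lemma Ee_eq0P (T : finType) (e : rel T) theta v :
  symmetric e ->
  Ee R e theta v = 0 <-> (forall f, eigfun e theta f -> f v = 0).
Proof.
move=> es; have := @Ee_proportionalP T e theta v v 0 es.
rewrite scale0r => h; split=> [/h h1 f /h1 ->|h1]; first by rewrite mul0r.
by apply/h => f /h1 ->; rewrite mul0r.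
Qed.

Lemma eig_supportP (T : finType) (e : rel T) theta v :
  symmetric e ->
  theta \in eig_support R e v <-> Ee R e theta v != 0.
Proof.
move=> es; rewrite /in_mem /= /eig_support; split=> [/andP[]//|Ev].
rewrite Ev andbT; apply: contraR Ev => /negPn/eqP E0.
apply/eqP/Ee_eq0P => // f /(eigfunP _ _ es); rewrite E0 submx0 => /eqP/rowP f0.
by have := f0 (enum_rank v); rewrite !mxE enum_rankK.
Qed.

(** * Vertex deletion, principal cofactors and cospectral vertices *)

Lemma det_reindex (K : comNzRingType) n1 n2 (A : 'M[K]_n1) (B : 'M[K]_n2)
    (h : 'I_n1 -> 'I_n2) :
  n1 = n2 -> injective h -> (forall i j, A i j = B (h i) (h j)) -> \det A = \det B.
Proof.
move=> E; case: _ / E B h => B h hI AB.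
(* Permuting rows and columns alike multiplies the determinant by the square of a sign. *)
have -> : A = row_perm (perm hI) (col_perm (perm hI) B).
  by apply/matrixP => i j; rewrite !mxE !permE.
rewrite row_permE col_permE !det_mulmx !det_perm odd_permV.
by rewrite mulrCA -signr_addb addbb mulr1.
Qed.

Lemma card_delv (T : finType) (v : T) : #|{: {x : T | x != v}}| = #|T|.-1.
Proof. by rewrite card_sig -(cardC1 v); apply: eq_card. Qed.

Lemma charp_delv (T : finType) (e : rel T) v :
  charp R (@delv T e v) = \adj (char_poly_mx (adjmx R e)) (enum_rank v) (enum_rank v).
Proof.
rewrite mxE /cofactor addnn -signr_odd odd_double mul1r.
have nv j : enum_val (lift (enum_rank v) j) != v.
  by rewrite -(inj_eq enum_rank_inj) enum_valK eq_sym neq_lift.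
pose h j : 'I_#|{: {x : T | x != v}}| :=
  enum_rank (Sub (enum_val (lift (enum_rank v) j)) (nv j)).
symmetry; apply: (@det_reindex _ _ _ _ _ h).
- by rewrite card_delv.
- by move=> i j /enum_rank_inj/(congr1 val)/= /enum_val_inj/lift_inj.
move=> i j; rewrite !mxE /delv !enum_rankK /=; congr (_ *+ _ - _).
by rewrite (inj_eq enum_rank_inj) -[in RHS]val_eqE /= (inj_eq enum_val_inj).
Qed.

(** Both quotients have the same nonzero numerator, which cancels. *)
Lemma alpha_eq_charp_delv (T : finType) (e : rel T) u v :
  alpha R e u = alpha R e v -> charp R (@delv T e u) = charp R (@delv T e v).
Proof.
rewrite /alpha => /mulfI h; apply/eqP; rewrite -(@tofrac_eq {poly R}).
apply/eqP/invr_inj/h.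
by rewrite tofrac_eq0 monic_neq0 ?char_poly_monic.
Qed.

(** The deleted characteristic polynomials are diagonal entries of the adjugate. Cancelling t^d in
    their expansions and evaluating at theta leaves g(theta) E_uu = g(theta) E_vv with g(theta)
    nonzero. *)
Lemma cospectral_eigproj_diag (T : finType) (e : rel T) theta u v :
  symmetric e -> alpha R e u = alpha R e v ->
  eigproj R e theta (enum_rank u) (enum_rank u) =
  eigproj R e theta (enum_rank v) (enum_rank v).
Proof.
move=> es /alpha_eq_charp_delv; rewrite !charp_delv.
have [g [Q [_ rg /matrixP tadj]]] := adj_char_poly_mx_expansion theta (adjmx_sym es).
set t := 'X - theta%:P in tadj => adjE.
have key x : t * \adj (char_poly_mx (adjmx R e)) x x =
    t ^+ mup theta (char_poly (adjmx R e)) *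
    (g * (eigproj R e theta x x)%:P + t * Q x x).
  by have := tadj x x; rewrite !mxE.
have td0 : t ^+ mup theta (char_poly (adjmx R e)) != 0.
  by rewrite expf_neq0 // polyXsubC_eq0.
move: (key (enum_rank u)); rewrite adjE key => /(mulfI td0)/(congr1 (horner^~ theta)).
by rewrite /t !hornerE subrr !mul0r !addr0 => /(mulfI rg) ->.
Qed.

(** * Schur complement at the root and the pole criterion *)

Definition rootvec (T : finType) (e : rel T) (r : T) : 'cV[R]_#|{: {x : T | x != r}}| :=
  \col_i (e r (val (enum_val i)))%:R.

(** The Schur complement with [\adj N] in place of the inverse stays within the ring: multiplying by
    a block triangular matrix of determinant [\det N] clears the lower left block, and the extra
    factor is cancelled. *)
Lemma det_schur (K : idomainType) n (a : K) (b : 'cV[K]_n) (N : 'M[K]_n) :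
  \det N != 0 ->
  \det (block_mx a%:M (- b^T) (- b) N : 'M_(1 + n)) =
  a * \det N - (b^T *m \adj N *m b) 0 0.
Proof.
move=> N0; set s := (X in _ - X).
have sE : b^T *m \adj N *m b = s%:M by rewrite [LHS]mx11_scalar.
apply: (mulIf N0).
have detL : \det (block_mx (\det N)%:M 0 (\adj N *m b) 1%:M : 'M_(1 + n)) = \det N.
  by rewrite det_lblock det_scalar1 det1 mulr1.
rewrite -[in LHS]detL -det_mulmx mulmx_block !mulmx1 !mulmx0 !add0r.
have -> : - b *m (\det N)%:M + N *m (\adj N *m b) = 0.
  by rewrite mulmxA mul_mx_adj mul_mx_scalar mul_scalar_mx scalerN addNr.
rewrite det_ublock mulmxA !mulNmx sE -scalar_mxM; congr (_ * _).
by rewrite -raddfB det_scalar1.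
Qed.

Lemma charp_schur (T : finType) (e : rel T) r (b := map_mx polyC (rootvec e r)) :
  symmetric e -> irreflexive e ->
  charp R e = 'X * charp R (@delv T e r)
    - (b^T *m \adj (char_poly_mx (adjmx R (@delv T e r))) *m b) 0 0.
Proof.
move=> es ei; rewrite -det_schur ?monic_neq0 ?char_poly_monic //.
(* The root is listed first, followed by the remaining vertices. *)
pose h (i : 'I_(1 + #|{: {x : T | x != r}}|)) : 'I_#|T| :=
  match split i with inl _ => enum_rank r | inr j => enum_rank (val (enum_val j)) end.
symmetry; apply: (@det_reindex _ _ _ _ _ h).
- by rewrite card_delv add1n prednK //; apply/card_gt0P; exists r.
- move=> i j; rewrite /h; case: (split_ordP i) => i' ->; case: (split_ordP j) => j' ->.
  + by rewrite !ord1.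
  + by move/enum_rank_inj => rE; have := valP (enum_val j'); rewrite -rE eqxx.
  + by move/enum_rank_inj => rE; have := valP (enum_val i'); rewrite rE eqxx.
  + by move/enum_rank_inj/val_inj/enum_val_inj => ->.
move=> i j; rewrite /h; case: (split_ordP i) => i' ->; case: (split_ordP j) => j' ->.
- by rewrite block_mxEul !ord1 !mxE !eqxx !enum_rankK ei subr0.
- rewrite block_mxEur !mxE !enum_rankK (inj_eq enum_rank_inj) eq_sym.
  by rewrite (negPf (valP (enum_val j'))) mulr0n sub0r.
- rewrite block_mxEdl !mxE !enum_rankK (inj_eq enum_rank_inj).
  by rewrite (negPf (valP (enum_val i'))) mulr0n sub0r es.
- rewrite block_mxEdr !mxE !enum_rankK (inj_eq enum_rank_inj) (inj_eq val_inj).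
  by rewrite (inj_eq enum_val_inj).
Qed.

Lemma delv_sym (T : finType) (e : rel T) r : symmetric e -> symmetric (@delv T e r).
Proof. by move=> es x y; apply: es. Qed.

(** With d the multiplicity of theta for the graph without r, a pole means that t^d does not divide
    [charp R e]. By the Schur formula t [charp R e] is t^d times a polynomial whose value at theta
    is -g(theta) b^T E b, with g(theta) nonzero. *)
Lemma alpha_poleE (T : finType) (e : rel T) r theta (b := rootvec e r) :
  symmetric e -> irreflexive e ->
  alpha_pole R e r theta = (b^T *m eigproj R (@delv T e r) theta *m b != 0).
Proof.
move=> es ei; rewrite /alpha_pole /is_pole.
have [g [Q [phiE rg tadj]]] :=
  adj_char_poly_mx_expansion theta (adjmx_sym (@delv_sym T e r es)).
rewrite mup_ltn; last by rewrite monic_neq0 ?char_poly_monic.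
set t := 'X - theta%:P in phiE tadj *; set d := mup _ _ in phiE tadj *.
have t0 : t != 0 by rewrite polyXsubC_eq0.
have td0 : t ^+ d != 0 by rewrite expf_neq0.
(* The adjugate expansion describes t times the adjugate, so the divisibility is first multiplied by
   t. *)
rewrite -(dvdp_mul2l _ _ t0) (charp_schur r) // mulrBr.
set b' := map_mx _ _; set s := (b^T *m _ *m b).
have -> : t * (b'^T *m \adj (char_poly_mx (adjmx R (@delv T e r))) *m b') 0 0 =
    t ^+ d * (g * (s 0 0)%:P + t * (b'^T *m Q *m b') 0 0).
  transitivity ((b'^T *m (t *: \adj (char_poly_mx (adjmx R (@delv T e r)))) *m b') 0 0).
    by rewrite -scalemxAr -scalemxAl [RHS]mxE.
  rewrite tadj -scalemxAr -scalemxAl [LHS]mxE mulmxDr mulmxDl -!scalemxAr -!scalemxAl.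
  congr (_ * _); rewrite [LHS]mxE; congr (_ + _); rewrite [LHS]mxE //; congr (_ * _).
  by rewrite map_trmx -!map_mxM [LHS]mxE.
have -> : t * ('X * charp R (@delv T e r)) = t ^+ d * (t * 'X * g).
  by rewrite /charp phiE !mulrA -[t * 'X * _]mulrC !mulrA.
rewrite -mulrBr (mulrC t (t ^+ d)) dvdp_mul2l // -root_factor_theorem rootE /t !hornerE.
rewrite subrr !mul0r addr0 sub0r oppr_eq0 mulf_eq0 -rootE (negPf rg) /=.
congr (~~ _); apply/eqP/eqP => [s0|->]; last by rewrite mxE.
by apply/matrixP => i j; rewrite !ord1 s0 mxE.
Qed.

(** * Test functions on a branch that detect poles *)

Definition ext (T : finType) (r : T) (a : R) (w : 'cV[R]_#|{: {x : T | x != r}}|)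
    (x : T) : R :=
  if insub x is Some y then w (enum_rank y) 0 else a.

Lemma ext_root (T : finType) (r : T) a w : @ext T r a w r = a.
Proof. by rewrite /ext insubF ?eqxx. Qed.

Lemma ext_val (T : finType) (r : T) a w (y : {x : T | x != r}) :
  @ext T r a w (val y) = w (enum_rank y) 0.
Proof. by rewrite /ext valK. Qed.

Lemma sum_adj_ext (T : finType) (e : rel T) r a w x :
  \sum_(y | e x y) @ext T r a w y =
  (e x r)%:R * a + \sum_(y : {x : T | x != r}) (e x (val y))%:R * w (enum_rank y) 0.
Proof.
rewrite big_mkcond (bigD1 r) //= ext_root.
congr (_ + _); first by case: (e x r); rewrite ?mul1r ?mul0r.
rewrite (big_sub [pred y | y != r]) /=; apply: eq_bigr => y _.
by rewrite ext_val; case: (e x _); rewrite ?mul1r ?mul0r.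
Qed.

Lemma shadj_ext_off (T : finType) (e : rel T) r theta a w
    (y : {x : T | x != r}) : symmetric e ->
  shadj e theta (@ext T r a w) (val y) =
  (a *: rootvec e r + (adjmx R (@delv T e r) - theta%:M) *m w) (enum_rank y) 0.
Proof.
move=> es; rewrite /shadj sum_adj_ext ext_val -addrA mulmxBl mul_scalar_mx.
rewrite !mxE enum_rankK es mulrC; congr (_ + (_ - _)).
rewrite -sum_enum_val; apply: eq_bigr => i _.
by rewrite !mxE enum_rankK enum_valK.
Qed.

Lemma shadj_ext_root (T : finType) (e : rel T) r theta w : irreflexive e ->
  shadj e theta (@ext T r 0 w) r = ((rootvec e r)^T *m w) 0 0.
Proof.
move=> ei; rewrite /shadj sum_adj_ext ext_root !mulr0 add0r subr0 mxE.
rewrite -sum_enum_val; apply: eq_bigr => i _.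
by rewrite !mxE enum_valK.
Qed.

Lemma alpha_pole_witness (T : finType) (e : rel T) r theta :
  symmetric e -> irreflexive e -> alpha_pole R e r theta ->
  exists y : T -> R, [/\ y r = 0, forall x, x != r -> shadj e theta y x = 0 &
    shadj e theta y r != 0].
Proof.
move=> es ei; rewrite alpha_poleE // => pole.
set E := eigproj _ _ _ in pole.
(* The eigenvector E b of the graph without r, extended by 0, has defect b^T E b at the root. *)
exists (ext 0 (E *m rootvec e r)); split; first exact: ext_root.
- move=> x xr; rewrite (shadj_ext_off _ _ _ (Sub x xr)) // scale0r add0r mulmxA.
  have -> : (adjmx R (@delv T e r) - theta%:M) *m E = 0.
    have As := adjmx_sym (@delv_sym T e r es).
    apply: trmx_inj; rewrite trmx_mul trmx0 linearB /= As tr_scalar_mx eigproj_sym.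
    by rewrite mulmxBr eigproj_mul mul_mx_scalar subrr.
  by rewrite mul0mx mxE.
rewrite shadj_ext_root // mulmxA; apply: contra pole => /eqP s0.
by apply/eqP/matrixP => i j; rewrite !ord1 s0 mxE.
Qed.

Lemma alpha_nonpole_witness (T : finType) (e : rel T) r theta :
  symmetric e -> irreflexive e -> ~~ alpha_pole R e r theta ->
  exists p : T -> R, p r = 1 /\ forall x, x != r -> shadj e theta p x = 0.
Proof.
move=> es ei; rewrite alpha_poleE // negbK => /eqP/eigproj_quad_eq0 Eb.
have As := adjmx_sym (@delv_sym T e r es).
have [P PE] := eigproj_compl theta As.
(* Since E b = 0, the vector w = -P^T b solves (A - theta) w = -b on the graph without r: the
   product (A - theta) P^T is 1 - E. *)
exists (ext 1 (- P^T *m rootvec e r)); split; first exact: ext_root.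
move=> x xr; rewrite (shadj_ext_off _ _ _ (Sub x xr)) // scale1r.
rewrite mulNmx mulmxN mulmxA.
have -> : (adjmx R (@delv T e r) - theta%:M) *m P^T =
    1%:M - eigproj R (@delv T e r) theta.
  apply: trmx_inj; rewrite trmx_mul trmxK linearB /= As tr_scalar_mx -PE.
  by rewrite linearB /= tr_scalar_mx eigproj_sym.
by rewrite mulmxBl mul1mx Eb subr0 subrr mxE.
Qed.

End Graph.

(** * Decorated paths *)

Section Path.
Variables (R : rcfType) (n : nat) (m : 'I_n.+1 -> nat).
Variables (e : forall k : 'I_n.+1, rel 'I_(m k)) (r : forall k : 'I_n.+1, 'I_(m k)).
Hypotheses (e_sym : forall k, symmetric (@e k)) (e_irr : forall k, irreflexive (@e k)).

Local Notation vtx := (Tagged (fun k : 'I_n.+1 => 'I_(m k))).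
Local Notation G := (dpath e r).
Local Notation adjp k l := ((k.+1 == l :> nat) || (l.+1 == k :> nat)).

Lemma dpath_branch k (u w : 'I_(m k)) : G (vtx u) (vtx w) = e u w.
Proof.
apply/orP/idP => [[]|euw].
- move=> /existsP[l /existsP[u' /existsP[w' /and3P[/eqP uu' /eqP ww' euw]]]].
  move: (congr1 tag uu') => /= kl; case: _ / kl u' w' uu' ww' euw => u' w'.
  by move=> /eqP; rewrite eq_Tagged /= => /eqP -> /eqP; rewrite eq_Tagged /= => /eqP ->.
(* A spine edge within one branch would make an index its own successor. *)
- move=> /existsP[k1 /existsP[k2 /andP[/eqP k12]]].
  by case/orP=> /andP[/eqP/(congr1 tag)/= E1 /eqP/(congr1 tag)/= E2];
    move: k12; rewrite -E1 -E2 => /eqP; rewrite (gtn_eqF (ltnSn _)).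
by left; apply/existsP; exists k; apply/existsP; exists u; apply/existsP; exists w;
  rewrite !eqxx.
Qed.

Lemma dpath_spine k l (u : 'I_(m k)) (w : 'I_(m l)) : k != l ->
  G (vtx u) (vtx w) = [&& adjp k l, u == r k & w == r l].
Proof.
move=> kl; apply/orP/and3P => [[]|[akl /eqP -> /eqP ->]].
- move=> /existsP[i /existsP[u' /existsP[w' /and3P[/eqP uu' /eqP ww' _]]]].
  move: (congr1 tag uu') (congr1 tag ww') => /= E1 E2.
  by rewrite E1 E2 eqxx in kl.
- move=> /existsP[k1 /existsP[k2 /andP[k12]]].
  case/orP=> /andP[/eqP uE /eqP wE].
    move: (congr1 tag uE) (congr1 tag wE) => /= E1 E2; subst k1 k2.
    move: uE wE => /eqP; rewrite eq_Tagged => uE /eqP; rewrite eq_Tagged => wE.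
    by rewrite k12.
  move: (congr1 tag uE) (congr1 tag wE) => /= E1 E2; subst k1 k2.
  move: uE wE => /eqP; rewrite eq_Tagged => uE /eqP; rewrite eq_Tagged => wE.
  by rewrite k12 orbT.
right; case/orP: akl => a.
  by apply/existsP; exists k; apply/existsP; exists l; rewrite a !eqxx.
by apply/existsP; exists l; apply/existsP; exists k; rewrite a !eqxx orbT.
Qed.

Lemma dpath_sym : symmetric G.
Proof.
case=> k u [l w]; have [E|kl] := eqVneq k l.
  by case: _ / E w => w; rewrite !dpath_branch e_sym.
by rewrite !dpath_spine // 1?eq_sym // orbC [(u == _) && _]andbC.
Qed.

Lemma sum_dpath (f : dvert m -> R) k (u : 'I_(m k)) :
  \sum_(y | G (vtx u) y) f y =
  \sum_(w | e u w) f (vtx w)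
    + (u == r k)%:R * \sum_(l : 'I_n.+1 | adjp k l) f (pathv r l).
Proof.
transitivity
    (\sum_l \sum_(w | G (vtx u) (vtx w)) f (@Tagged _ l (fun k => 'I_(m k)) w)).
  by rewrite (sig_big_dep _ _ _) /=; apply: eq_big => [] [].
rewrite (bigD1 k) //=; congr (_ + _); first by apply: eq_bigl => w; apply: dpath_branch.
rewrite mulr_sumr [RHS]big_mkcond [LHS]big_mkcond; apply: eq_bigr => l _.
have [->|lk] /= := eqVneq l k; first by rewrite (gtn_eqF (ltnSn _)).
rewrite (eq_bigl (fun w => [&& adjp k l, u == r k & w == r l])); last first.
  by move=> w; rewrite dpath_spine // eq_sym.
case: ifP => _ /=; last by rewrite big_pred0.
case: eqP => _ /=; last by rewrite mul0r big_pred0.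
by rewrite mul1r (big_pred1 (r l)).
Qed.

(** Branches meet the rest of the graph only at their roots, so the spine enters the equation at
    roots alone. *)
Lemma shadj_dpath theta (f : dvert m -> R) k (u : 'I_(m k)) :
  shadj G theta f (vtx u) = shadj (@e k) theta (fun w => f (vtx w)) u
    + (u == r k)%:R * \sum_(l : 'I_n.+1 | adjp k l) f (pathv r l).
Proof. by rewrite /shadj sum_dpath addrAC. Qed.

Section Eigenfunction.
Variables (theta : R) (f : dvert m -> R).
Hypothesis f_eig : eigfun G theta f.

Lemma eigfun_branch_off k (u : 'I_(m k)) : u != r k ->
  shadj (@e k) theta (fun w => f (vtx w)) u = 0.
Proof.
by move=> ur; have := f_eig (vtx u); rewrite shadj_dpath (negPf ur) mul0r addr0.
Qed.

Lemma eigfun_spine (k : 'I_n.+1) :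
  \sum_(l : 'I_n.+1 | adjp k l) f (pathv r l) =
  - shadj (@e k) theta (fun w => f (vtx w)) (r k).
Proof.
have /eqP := f_eig (pathv r k).
by rewrite shadj_dpath eqxx mul1r addrC addr_eq0 => /eqP.
Qed.

(** Without poles, [eigfun_spine] is a three-term recurrence along the path, so a zero at the first
    path vertex propagates by strong induction. Applied to differences, it shows that the first path
    entry determines the others. *)
Lemma eigfun_vanish_spine :
  (forall k, ~~ alpha_pole R (@e k) (r k) theta) -> f (pathv r ord0) = 0 ->
  forall k, f (pathv r k) = 0.
Proof.
move=> nopole f0 k; have [i] := ubnP (k : nat).
elim: i k => [//|i IH] k; rewrite ltnS leq_eqVlt => /orP[/eqP ki|]; last exact: IH.
case: i => [|i] in IH ki.
  by have -> : k = ord0 by apply: val_inj.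
have ltin : (i < n.+1)%N by rewrite ltnW // -ki.
pose j := Ordinal ltin.
have [p [pr poff]] := alpha_nonpole_witness (@e_sym j) (@e_irr j) (nopole j).
have := root_pairing (@e_sym j) (fun u => @eigfun_branch_off j u) poff.
(* Besides k = j + 1, the only possible path neighbour of j is j - 1, where f vanishes by induction;
   the defect at j vanishes because f does at j. *)
have := eigfun_spine j; rewrite (bigD1 k) /=; last by rewrite ki eqxx.
rewrite big1 ?addr0 => [->|l /andP[/orP[/eqP jl|/eqP lj] lk]].
- by rewrite pr mul1r => ->; rewrite [f _](IH j) ?mul0r ?oppr0 //=.
- by case/eqP: lk; apply: ord_inj; rewrite -jl ki.
- by apply: IH; rewrite -lj ltnS ltnW.
Qed.

(* At a pole theta of alpha_k every eigenfunction vanishes at path vertex k, so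
   it can be cut there; the resulting imbalance at k is absorbed by a multiple
   of the pole witness y, which lives on the branch G_k. *)
Lemma eigfun_cut (k : 'I_n.+1) : alpha_pole R (@e k) (r k) theta ->
  f (pathv r k) = 0 /\
  exists g, [/\ eigfun G theta g, g (pathv r ord_max) = 0 &
    (0 < k)%N -> g (pathv r ord0) = f (pathv r ord0)].
Proof.
move=> pole.
have [y [yr yoff ydef]] := alpha_pole_witness (@e_sym k) (@e_irr k) pole.
have fk0 : f (pathv r k) = 0.
  have := root_pairing (@e_sym k) (fun u => @eigfun_branch_off k u) yoff.
  by rewrite yr mul0r => /esym/eqP; rewrite mulf_eq0 (negPf ydef) orbF => /eqP.
split=> //.
pose f0 (x : dvert m) := if (tag x < k)%N then f x else 0.
(* This multiple of y cancels the spine sum of the truncated function at k. *)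
pose c := - (\sum_(l : 'I_n.+1 | adjp k l) f0 (pathv r l)) / shadj (@e k) theta y (r k).
(* The function y on [G_k] extended by zero; a sum with at most one term avoids casting between
   dependent branch types. *)
pose Y (x : dvert m) := \sum_(w | x == vtx w) y w.
pose g x := f0 x + c * Y x.
have Yk (w : 'I_(m k)) : Y (vtx w) = y w.
  by rewrite /Y (big_pred1 w) // => w'; rewrite eq_Tagged eq_sym.
have Yl l (w : 'I_(m l)) : l != k -> Y (vtx w) = 0.
  move=> lk; rewrite /Y big_pred0 // => w'.
  by apply/eqP => /(congr1 tag)/= E; rewrite E eqxx in lk.
have Yr l : Y (pathv r l) = 0.
  have [->|lk] := eqVneq l k; first by rewrite Yk.
  exact: Yl.
have gr l : g (pathv r l) = if (l < k)%N then f (pathv r l) else 0.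
  by rewrite /g Yr mulr0 addr0.
exists g; split.
- case=> l u; rewrite -[existT _ l u]/(vtx u) shadj_dpath.
  have [lk|kl|E] := ltngtP l k.
  + rewrite -[RHS](f_eig (vtx u)) shadj_dpath; congr (_ + _ * _).
      have gE w : g (@Tagged _ l (fun k => 'I_(m k)) w) = f (vtx w).
        by rewrite /g Yl ?mulr0 ?addr0 /f0 /= ?lk // -val_eqE /= ltn_eqF.
      by rewrite /shadj gE; congr (_ - _); apply: eq_bigr => w _; rewrite gE.
    (* A path neighbour of l < k lies left of k or equals k, and there f is zero as well. *)
    apply: eq_bigr => l' ll'; rewrite gr; case: ltngtP => // [kl'|/val_inj ->//].
    by case/orP: ll' => /eqP E; lia.
  + have gE w : g (@Tagged _ l (fun k => 'I_(m k)) w) = 0.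
      rewrite /g Yl ?mulr0 ?addr0 /f0 /= ?ltnNge ?(ltnW kl) //.
      by rewrite -val_eqE /= gtn_eqF.
    rewrite /shadj gE mulr0 subr0 big1 ?add0r => [|w _]; last exact: gE.
    rewrite big1 ?mulr0 // => l' ll'; rewrite gr ltnNge.
    by case: leqP => // l'k; case/orP: ll' => /eqP E; lia.
  + move/val_inj: E => E; subst l.
    have gE w : g (@Tagged _ k (fun k => 'I_(m k)) w) = c * y w.
      by rewrite /g /f0 /= ltnn add0r Yk.
    have -> : shadj (@e k) theta (fun w => g (vtx w)) u = c * shadj (@e k) theta y u.
      rewrite /shadj gE mulrBr mulr_sumr mulrCA; congr (_ - _).
      by apply: eq_bigr => w _; rewrite gE.
    have [->|ur] := eqVneq u (r k); last by rewrite mul0r addr0 yoff ?mulr0.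
    rewrite mul1r /c divfK // addrC; apply/eqP; rewrite subr_eq0; apply/eqP.
    by apply: eq_bigr => l _; rewrite gr.
- by rewrite gr ltnNge -ltnS ltn_ord.
- by move=> k0; rewrite gr k0.
Qed.

End Eigenfunction.
End Path.

Theorem theorem7 (R : rcfType) (n : nat) (m : 'I_n.+1 -> nat)
    (e : forall k : 'I_n.+1, rel 'I_(m k)) (r : forall k : 'I_n.+1, 'I_(m k))
    (e_sym : forall k, symmetric (e k)) (e_irr : forall k, irreflexive (e k)) :
  alpha R (dpath e r) (pathv r ord0) = alpha R (dpath e r) (pathv r ord_max) ->
  (strongly_cospectral R (dpath e r) (pathv r ord0) (pathv r ord_max) <->
   forall theta : R, theta \in eig_support R (dpath e r) (pathv r ord0) ->
     forall k : 'I_n.+1, ~~ alpha_pole R (e k) (r k) theta).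
Proof.
move=> alphaE; have Gs := dpath_sym r e_sym.
split=> [sc theta supp k|nopole theta eig].
  apply/negP => pole.
  have /(eig_supportP _ _ Gs) E0 := supp.
  have sgn : exists c, forall f, eigfun (dpath e r) theta f ->
      f (pathv r ord0) = c * f (pathv r ord_max).
    case/andP: supp => /sc[] E _; [exists 1|exists (-1)];
      by apply/(Ee_proportionalP theta _ _ _ Gs); rewrite ?scale1r ?scaleN1r.
  case: sgn => c sgn; case/negP: E0; apply/eqP/(Ee_eq0P _ _ Gs) => f f_eig.
  have [fk0 [g [g_eig gn g0]]] := eigfun_cut e_sym e_irr f_eig pole.
  (* For k > 0 the cut function has the same first entry as f but last entry 0. For k = 0 the cut
     would discard everything, but then f already vanishes at the first path vertex. *)
  have [k0|k0] := posnP (k : nat); last by rewrite -(g0 k0) (sgn g g_eig) gn mulr0.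
  have <- : k = ord0 by apply: ord_inj.
  exact: fk0.
have diagE := cospectral_eigproj_diag theta Gs alphaE.
set x0 := pathv r ord0 in nopole alphaE diagE *.
set xn := pathv r ord_max in alphaE diagE *.
(* If E_11 = E_nn = 0, both projected vectors are zero. Otherwise theta lies in the support and the
   hypothesis on poles applies. *)
have [d0|d0] := eqVneq (eigproj R (dpath e r) theta (enum_rank x0) (enum_rank x0)) 0.
  by left; rewrite (Ee_diag_eq0 Gs d0) (Ee_diag_eq0 Gs (etrans (esym diagE) d0)).
have {}nopole k : ~~ alpha_pole R (e k) (r k) theta.
  apply/nopole/(eig_supportP _ _ Gs); apply: contra d0 => /eqP/colP/(_ (enum_rank x0)).
  by rewrite /Ee mul_stdvec [RHS]mxE => ->; rewrite eqxx.
(* This row of E is an eigenfunction with f x0 = E_11 nonzero, hence a reference solution.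
   Subtracting a multiple of it from any eigenfunction g gives one vanishing at x0, so at xn too. *)
pose f x := eigproj R (dpath e r) theta (enum_rank x0) (enum_rank x).
have f_eig : eigfun (dpath e r) theta f by exact: eigfun_eigproj Gs.
have EnE : Ee R (dpath e r) theta xn = (f xn / f x0) *: Ee R (dpath e r) theta x0.
  apply/(Ee_proportionalP _ _ _ _ Gs) => g g_eig.
  have h_eig : eigfun (dpath e r) theta (fun x => g x - (g x0 / f x0) * f x).
    move=> x; rewrite shadjB shadjZ.
    by rewrite g_eig f_eig mulr0 subr0.
  have h0 : g x0 - g x0 / f x0 * f x0 = 0.
    by rewrite (divfK (d0 : f x0 != 0)) subrr.
  have /subr0_eq gn := eigfun_vanish_spine e_sym e_irr h_eig nopole h0 ord_max.
  by rewrite [LHS]gn mulrAC [RHS]mulrAC (mulrC (f xn)).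
(* Here E_nn = c^2 E_11 and E_nn = E_11 is nonzero, so c^2 = 1 for c = f xn / f x0. *)
have /eqP := Ee_proportional_diag Gs EnE; rewrite -diagE.
rewrite -subr_eq0 -{1}[eigproj _ _ _ _ _]mul1r -mulrBl mulf_eq0 (negPf d0) orbF.
rewrite subr_eq0 eq_sym sqrf_eq1 => /orP[]/eqP c1; [left|right].
  by rewrite EnE c1 scale1r.
by rewrite EnE c1 scaleN1r opprK.
Qed.
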